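(* Let $m \geq 6$ be an integer and let $H$ be the complex Hilbert space of dimension $2m^3+8m^2+7m+2$ with a fixed orthonormal basis consisting of vectors $a_i$ ($1\le i\le m^2$), $b_i$ ($1\le i\le 2m+1$), $c_{ij}$ ($1\le i<j\le 2m+1$) and $d_{ij}$ ($1\le i\le 2m+1$, $1\le j\le (m+1)^2$). Let $\mathcal{D}\subset B(H)$ be the algebra of operators that are diagonal with respect to this basis. Define $$v_0=\sum_{i=1}^{m^2}\frac{1}{m+1}a_i+\sum_{i=1}^{2m+1}\frac{1}{m+1}b_i,$$ and for $1\le i\le 2m+1$ $$v_i=\sum_{j=1}^{m^2}\frac{-1}{m^2(m+1)}a_j+\frac{1}{m+1}b_i+\sum_{j=1}^{i-1}\frac{1}{m(m+1)}c_{ji}+\sum_{j=i+1}^{2m+1}\frac{-1}{m(m+1)}c_{ij}+\sum_{j=1}^{(m+1)^2}\frac1m\sqrt{\frac{m-1}{m+1}}\,d_{ij}.$$ Then $v_0,v_1,\dots,v_{2m+1}$ are orthonormal, and if $p$ denotes the orthogonal projection of $H$ onto their span, then $\delta_p=\frac{2}{(m+1)^2}$ and for every symmetry $s\in\mathcal{D}$ $$\|psp\|\ \ge\ \frac{\sqrt{2m+1}}{4}\,\delta_p .$$ In particular, the following assertion (a conjecture of Akemann and Anderson) is false: for every $n \ge 1$ and every projection $p\in M_n(\mathbb{C})$ there exists a symmetry $s$ in the algebra of diagonal $n\times n$ matrices such that $\|psp\|\le 2\delta_p$.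
   Context: A projection is a self-adjoint idempotent operator. A symmetry is a self-adjoint unitary; thus a symmetry that is diagonal in a given orthonormal basis is a diagonal operator with all diagonal entries $\pm1$. For a projection $p$ on a finite dimensional complex Hilbert space with a fixed orthonormal basis $\{e_k\}$ (for $\mathbb{C}^n$, the standard basis), $\delta_p=\max_k\langle pe_k,e_k\rangle$. $\|\cdot\|$ applied to operators is the operator norm. *)

(* Defs.v *)
From HB Require Import structures.
From mathcomp Require Import all_boot all_order all_algebra.
From mathcomp Require Import complex.
From mathcomp Require Import boolp classical_sets reals.

Set Implicit Arguments.
Unset Strict Implicit.
Unset Printing Implicit Defensive.

Import Order.TTheory GRing.Theory Num.Theory.
Local Open Scope ring_scope.
Local Open Scope complex_scope.
Local Open Scope classical_set_scope.

(* The Hilbert space C^n is 'rV[R[i]]_n with the inner product [dotmx], which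
   is linear in its first argument. As in [mxalgebra] and [spectral], a matrix A
   stands for the operator u |-> u *m A. *)

Section Operators.
Variables (R : realType) (n : nat).
Local Notation C := R[i].
Implicit Types (A p s : 'M[C]_n) (u : 'rV[C]_n).

Definition l2norm u : R := Num.sqrt (complex.Re (dotmx u u)).

Definition opnorm A : R := sup [set l2norm (u *m A) | u in [set u | l2norm u <= 1]].

Definition is_projection p : Prop := p \is hermsymmx /\ p *m p = p.

Definition is_symmetry s : Prop := s \is hermsymmx /\ s \is unitarymx.

Definition is_onb (K : finType) (e : K -> 'rV[C]_n) : Prop :=
  orthonormal (@dotmx C n) (codom e) /\ basis_of fullv (codom e).

Definition diagonal_in (K : finType) (e : K -> 'rV[C]_n) A : Prop :=
  forall k, exists l : C, e k *m A = l *: e k.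

(* For a projection p the numbers <p e_k, e_k> are real and nonnegative, so
   taking real parts and starting the maximum at 0 is harmless. *)
Definition delta (K : finType) (e : K -> 'rV[C]_n) p : R :=
  \big[Num.max/0]_(k : K) complex.Re (dotmx (e k *m p) (e k)).

Definition std_basis (k : 'I_n) : 'rV[C]_n := delta_mx 0 k.

End Operators.

Arguments std_basis : clear implicits.

Definition Akemann_Anderson_conjecture (R : realType) : Prop :=
  forall n : nat, (1 <= n)%N -> forall p : 'M[R[i]]_n, is_projection p ->
  exists s : 'M[R[i]]_n,
    [/\ is_symmetry s, is_diag_mx s
      & opnorm (p *m s *m p) <= 2 * delta (std_basis R n) p].

Definition dimH (m : nat) : nat := (2 * m ^ 3 + 8 * m ^ 2 + 7 * m + 2)%N.

(* Labels of the basis vectors a_i, b_i, c_ij (i < j) and d_ij. *)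
Definition basis_index (m : nat) : finType :=
  ('I_(m ^ 2) + 'I_(2 * m + 1)
   + {ij : 'I_(2 * m + 1) * 'I_(2 * m + 1) | (ij.1 < ij.2)%N}
   + 'I_(2 * m + 1) * 'I_((m + 1) ^ 2))%type.

Section Vectors.
Variables (R : realType) (m : nat).
Local Notation C := R[i].
Local Notation H := 'rV[C]_(dimH m).
Variables (a : 'I_(m ^ 2) -> H) (b : 'I_(2 * m + 1) -> H).
Variables (c : 'I_(2 * m + 1) -> 'I_(2 * m + 1) -> H).
Variables (d : 'I_(2 * m + 1) -> 'I_((m + 1) ^ 2) -> H).

(* c i j is a basis vector only when i < j; its other values are never used. *)
Definition basis_vector (k : basis_index m) : H :=
  match k with
  | inl (inl (inl i)) => a i
  | inl (inl (inr i)) => b i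
  | inl (inr ij) => c (val ij).1 (val ij).2
  | inr ij => d ij.1 ij.2
  end.

Definition v0 : H :=
  \sum_i (1 / (m%:R + 1)) *: a i + \sum_i (1 / (m%:R + 1)) *: b i.

Definition v (i : 'I_(2 * m + 1)) : H :=
  \sum_j (- 1 / (m%:R ^+ 2 * (m%:R + 1))) *: a j
  + (1 / (m%:R + 1)) *: b i
  + \sum_(j < 2 * m + 1 | (j < i)%N) (1 / (m%:R * (m%:R + 1))) *: c j i
  + \sum_(j < 2 * m + 1 | (i < j)%N) (- 1 / (m%:R * (m%:R + 1))) *: c i j
  + \sum_j (1 / m%:R * Num.sqrt ((m%:R - 1) / (m%:R + 1)) : R)%:C *: d i j.

(* v_0, v_1, ..., v_(2m+1) as the rows of a matrix. *)
Definition vmx : 'M[C]_(1 + (2 * m + 1), dimH m) := col_mx v0 (\matrix_i v i).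

End Vectors.

(* Main.v *)
Require Import Defs.
From mathcomp Require Import all_boot all_order all_algebra.
From mathcomp Require Import complex.
From mathcomp Require Import boolp classical_sets reals.
From mathcomp Require Import ring lra zify.

Set Implicit Arguments.
Unset Strict Implicit.
Unset Printing Implicit Defensive.

Import Order.TTheory GRing.Theory Num.Theory.
Local Open Scope ring_scope.
Local Open Scope complex_scope.

(** Let [N = 2 m + 1]. Since [v_0] is a unit vector fixed by [p], the norm of
    [p s p] is at least that of [v_0 s p], and
      [|v_0 s p|^2 = |<v_0 s, v_0>|^2 + \sum_i |<v_0 s, v_i>|^2].
    If [s] has the diagonal entries [alpha_i] at [a_i] and [beta_i] at [b_i],
    and [A], [B] are the sums of the [alpha_i] and of the [beta_i], this is
      [((A + B)^2 + \sum_i (beta_i - A / m^2)^2) / (m + 1)^4].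
    The sum over [i] is at least [N - 2 A B / m^2], while [(A + B)^2 >= 4 A B],
    so [|p s p| >= sqrt N / (m + 1)^2 = (sqrt N / 2) delta_p]: twice the stated
    bound, and more than [2 delta_p] as soon as [m >= 8]. *)

(** * Orthonormal families and boundedness of the operator norm *)

Lemma orthonormal_codomP (C : numClosedFieldType) n (K : finType)
    (e : K -> 'rV[C]_n) :
  reflect (forall k l, dotmx (e k) (e l) = (k == l)%:R)
          (orthonormal (@dotmx C n) (codom e)).
Proof.
apply: (iffP orthonormalP) => [[/injectiveP e_inj eE] k l|eE].
  by rewrite eE ?codom_f // (inj_eq e_inj).
(* Two equal members have inner product 1, which forces their indices to agree. *)
have e_inj : injective e.
  move=> k l ekl; apply/eqP; have := eE k l.
  by rewrite ekl (eE l l) eqxx => /esym/eqP; rewrite pnatr_eq1 eqb1.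
split; first exact/injectiveP.
by move=> _ _ /codomP[k ->] /codomP[l ->]; rewrite (inj_eq e_inj); exact: eE.
Qed.

Section Opnorm.
Local Open Scope classical_set_scope.
Variables (R : realType) (n : nat).
Local Notation C := R[i].
Implicit Types (A : 'M[C]_n) (u : 'rV[C]_n).

Lemma dotmx_sum u w : dotmx u w = \sum_j u 0 j * (w 0 j)^*.
Proof. by rewrite dotmxE mxE; apply: eq_bigr => j _; rewrite !mxE. Qed.

Lemma dotmx_norm u : dotmx u u = \sum_j `|u 0 j| ^+ 2.
Proof. by rewrite dotmx_sum; apply: eq_bigr => j _; rewrite normCK. Qed.

Lemma Re_dotmx_ge0 u : 0 <= complex.Re (dotmx u u).
Proof.
have : 0 <= dotmx u u by rewrite dotmx_norm sumr_ge0 // => j _; rewrite exprn_ge0.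
by rewrite lecE => /andP[].
Qed.

Lemma Re_dotmxK u : (complex.Re (dotmx u u))%:C = dotmx u u.
Proof.
apply/RRe_real/ger0_real; rewrite dotmx_norm sumr_ge0 // => j _.
by rewrite exprn_ge0.
Qed.

(** Without an upper bound [sup] would be a default value. The entries of a vector in the unit ball
    have modulus at most 1, so entry [j] of [u *m A] is bounded by the absolute sum of column [j] of
    [A]. *)
Lemma opnorm_has_ubound A :
  has_ubound [set l2norm (u *m A) | u in [set u | l2norm u <= 1]].
Proof.
pose B : C := \sum_j (\sum_i `|A i j|) ^+ 2.
exists (Num.sqrt (complex.Re B)) => _ [u /= u1 <-].
rewrite /l2norm ler_wsqrtr //.
suff : dotmx (u *m A) (u *m A) <= B by rewrite lecE => /andP[].
have u_le1 i : `|u 0 i| <= 1.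
  rewrite -(@expr_le1 _ 2) //.
  have : dotmx u u <= 1.
    rewrite -Re_dotmxK -[1]/(1%:C) lecR.
    by rewrite -(sqr_sqrtr (Re_dotmx_ge0 u)) expr_le1 ?sqrtr_ge0.
  apply: le_trans; rewrite dotmx_norm (bigD1 i) //= lerDl sumr_ge0 // => j _.
  by rewrite exprn_ge0.
rewrite dotmx_norm; apply: ler_sum => j _; rewrite lerXn2r ?nnegrE //.
  by rewrite sumr_ge0.
rewrite mxE (le_trans (ler_norm_sum _ _ _)) //; apply: ler_sum => i _.
by rewrite normrM ler_piMl.
Qed.

Lemma le_opnorm A u : l2norm u <= 1 -> l2norm (u *m A) <= opnorm A.
Proof. by move=> u1; apply: ub_le_sup (opnorm_has_ubound A) _ _; exists u. Qed.

End Opnorm.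

(** * Orthogonal projection onto the span of orthonormal rows *)

Section Projection.
Local Open Scope sesquilinear_scope.
Variables (C : numClosedFieldType) (m n : nat) (V : 'M[C]_(m, n)).
Hypothesis V_unitary : V \is unitarymx.
Implicit Types x y : 'rV[C]_n.

(** The projection kills the rows of [1 - V^* V], which are orthogonal to those of [V], and it fixes
    the rows of [V]. *)
Lemma proj_ortho_unitaryE : proj_ortho V = V ^t* *m V.
Proof.
have : (1%:M - V ^t* *m V) *m proj_ortho V = 0.
  apply: proj_ortho_0; apply/orthomx1P.
  by rewrite mulmxBl mul1mx -mulmxA (unitarymxP V_unitary) mulmx1 subrr.
rewrite mulmxBl mul1mx -mulmxA proj_ortho_id ?submx_refl //.
by move/subr0_eq.
Qed.

Lemma trmxC_mul p q r (A : 'M[C]_(p, q)) (B : 'M[C]_(q, r)) :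
  (A *m B) ^t* = B ^t* *m A ^t*.
Proof. by rewrite trmx_mul map_mxM. Qed.

Lemma trmxCK p q (A : 'M[C]_(p, q)) : A ^t* ^t* = A.
Proof. by apply/matrixP => i j; rewrite !mxE conjCK. Qed.

Lemma proj_ortho_hermitian : proj_ortho V \is hermsymmx.
Proof.
apply/is_hermitianmxP; rewrite scale1r proj_ortho_unitaryE.
by rewrite trmxC_mul trmxCK.
Qed.

(** By the formula [V^* V], the left side is the inner product of the coordinate vectors [x V^*] and
    [y V^*]. *)
Lemma dotmx_proj_ortho x y :
  dotmx (x *m proj_ortho V) y =
  \sum_i dotmx x (row i V) * (dotmx y (row i V))^*.
Proof.
rewrite proj_ortho_unitaryE dotmxE.
have -> : x *m (V ^t* *m V) *m y ^t* = x *m V ^t* *m (y *m V ^t*) ^t*.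
  by rewrite trmxC_mul trmxCK !mulmxA.
have VE (z : 'rV[C]_n) i : (z *m V ^t*) 0 i = dotmx z (row i V).
  by rewrite dotmxE !mxE; apply: eq_bigr => j _; rewrite !mxE.
by rewrite mxE; apply: eq_bigr => i _; rewrite VE [X in _ * X]mxE [X in _ * Num.conj X]mxE VE.
Qed.

Lemma dotmx_hermitian (A : 'M[C]_n) x y :
  A \is hermsymmx -> dotmx x (y *m A) = dotmx (x *m A) y.
Proof.
move=> /is_hermitianmxP; rewrite scale1r => A_herm.
by rewrite !dotmxE trmxC_mul mulmxA -A_herm.
Qed.

End Projection.

(** * Real combinations of an orthonormal family and diagonal symmetries *)

Section RealCombinations.
Variables (R : realType) (n : nat) (K : finType) (e : K -> 'rV[R[i]]_n).
Implicit Types f g : K -> R.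

(** The coefficients of all the [v_i] are real, and so are the eigenvalues of a symmetry; inner
    products thus become sums over [R]. *)
Definition real_comb f : 'rV[R[i]]_n := \sum_k (f k)%:C *: e k.

Hypothesis dot_e : forall k l, dotmx (e k) (e l) = (k == l)%:R.

Lemma dotmx_basis_real_comb k f : dotmx (e k) (real_comb f) = (f k)%:C.
Proof.
rewrite linear_sumr /= (bigD1 k) //= big1 ?addr0 => [|l lk].
  by rewrite linearZr_LR /= dot_e eqxx mulr1; apply: conjc_real.
by rewrite linearZr_LR /= dot_e eq_sym (negPf lk) mulr0.
Qed.

Lemma dotmx_real_comb f g :
  dotmx (real_comb f) (real_comb g) = (\sum_k f k * g k)%:C.
Proof.
rewrite linear_sumlz /= rmorph_sum /=; apply: eq_bigr => k _.
by rewrite linearZl_LR /= dotmx_basis_real_comb rmorphM.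
Qed.

End RealCombinations.

Section Symmetry.
Variables (R : realType) (n : nat) (K : finType) (e : K -> 'rV[R[i]]_n).
Hypothesis dot_e : forall k l, dotmx (e k) (e l) = (k == l)%:R.

(** Self-adjoint and unitary together give [s *m s = 1], so every eigenvalue squares to 1 and is the
    real number 1 or -1. *)
Lemma symmetry_diagonalE (s : 'M[R[i]]_n) :
  is_symmetry s -> diagonal_in e s ->
  exists2 sg : K -> R, forall k, sg k ^+ 2 = 1 &
    forall f, real_comb e f *m s = real_comb e (fun k => sg k * f k).
Proof.
move=> [s_herm s_unit] s_diag.
have ss : s *m s = 1%:M.
  rewrite -(unitarymxP s_unit); congr (_ *m _).
  by have /is_hermitianmxP := s_herm; rewrite scale1r.
have sgP k : exists x : R, x ^+ 2 = 1 /\ e k *m s = x%:C *: e k.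
  have [l el] := s_diag k.
  have l2 : l ^+ 2 = 1.
    have : dotmx (e k *m s *m s) (e k) = 1.
      by rewrite -mulmxA ss mulmx1 dot_e eqxx.
    rewrite el -scalemxAl el scalerA linearZl_LR /= dot_e eqxx mulr1.
    by rewrite expr2.
  have /orP[/eqP l1|/eqP l1] : (l == 1) || (l == -1) by rewrite -sqrf_eq1 l2.
    by exists 1; rewrite expr1n el l1.
  by exists (-1); rewrite sqrrN expr1n el l1 rmorphN.
have [sg sgE] := choice sgP.
exists sg => [k|f]; first by case: (sgE k).
rewrite /real_comb mulmx_suml; apply: eq_bigr => k _.
by rewrite -scalemxAl (sgE k).2 scalerA -rmorphM mulrC.
Qed.

End Symmetry.

(** * Coordinates of the vectors [v_0] and [v_i] *)

Lemma sum_ltn_symmetric (R : pzRingType) n (g : 'I_n -> 'I_n -> R) :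
  (forall j k, g j k = g k j) -> (forall j, g j j = 0) ->
  \sum_j \sum_k g j k =
  2 * \sum_(jk : 'I_n * 'I_n | (jk.1 < jk.2)%N) g jk.1 jk.2.
Proof.
move=> gC g0; rewrite pair_bigA /=.
rewrite (bigID (fun jk : 'I_n * 'I_n => (jk.1 < jk.2)%N)) /=.
rewrite mulr_natl mulr2n.
congr (_ + _).
(* The remaining pairs are those with [k < j], matched with the first half by swapping the indices,
   and the diagonal, where [g] vanishes. *)
rewrite (bigID (fun jk : 'I_n * 'I_n => (jk.2 < jk.1)%N)) /= addrC big1 ?add0r.
  rewrite (reindex (fun jk : 'I_n * 'I_n => (jk.2, jk.1))) /=; last first.
    by exists (fun jk => (jk.2, jk.1)) => -[].
  apply: eq_big => [[j k]|[j k] _] /=; last exact: gC.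
  by case: ltngtP.
move=> [j k] /=; case: ltngtP => // /val_inj -> _; exact: g0.
Qed.

Section Coefficients.
Variables (R : realType) (m : nat).
Local Notation N := (2 * m + 1)%N.
Local Notation K := (basis_index m).

Lemma sum_basis_index (V : nmodType) (F : K -> V) :
  \sum_k F k =
  \sum_i F (inl (inl (inl i))) + \sum_i F (inl (inl (inr i)))
  + \sum_ij F (inl (inr ij)) + \sum_i \sum_j F (inr (i, j)).
Proof.
rewrite !big_sumType /=; congr (_ + _).
by rewrite pair_bigA; apply: eq_bigr => -[].
Qed.

Lemma sum_ltn_pairs (V : nmodType) (F : 'I_N * 'I_N -> V) :
  \sum_(ij : {ij : 'I_N * 'I_N | (ij.1 < ij.2)%N}) F (val ij)
  = \sum_(ij : 'I_N * 'I_N | (ij.1 < ij.2)%N) F ij.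
Proof. by rewrite -(big_sub (fun ij : 'I_N * 'I_N => (ij.1 < ij.2)%N)). Qed.

Definition coef0 (k : K) : R :=
  if k is inl (inl _) then (m%:R + 1)^-1 else 0.

(** At [c_jk] the two sums in [v_i] merge into a difference of indicators: 1 if [i] is the larger
    index [k], -1 if it is the smaller index [j], 0 otherwise. *)
Definition coef (i : 'I_N) (k : K) : R :=
  match k with
  | inl (inl (inl _)) => - (m%:R ^+ 2 * (m%:R + 1))^-1
  | inl (inl (inr j)) => (j == i)%:R * (m%:R + 1)^-1
  | inl (inr jk) =>
    (((val jk).2 == i)%:R - ((val jk).1 == i)%:R) * (m%:R * (m%:R + 1))^-1
  | inr jl =>
    (jl.1 == i)%:R * (m%:R^-1 * Num.sqrt ((m%:R - 1) / (m%:R + 1)))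
  end.

Lemma sum_delta (V : pzSemiRingType) (i : 'I_N) (F : 'I_N -> V) :
  \sum_j (j == i)%:R * F j = F i.
Proof.
rewrite (bigD1 i) //= eqxx mul1r big1 ?addr0 // => j /negPf ->.
by rewrite mul0r.
Qed.

Section Vectors.
Variables (a : 'I_(m ^ 2) -> 'rV[R[i]]_(dimH m)) (b : 'I_N -> 'rV[R[i]]_(dimH m)).
Variables (c : 'I_N -> 'I_N -> 'rV[R[i]]_(dimH m)).
Variables (d : 'I_N -> 'I_((m + 1) ^ 2) -> 'rV[R[i]]_(dimH m)).
Local Notation e := (basis_vector a b c d).

Lemma v0_real_comb : v0 a b = real_comb e coef0.
Proof.
rewrite /real_comb sum_basis_index /= [X in _ + X]big1 ?addr0 => [|i _].
  rewrite [X in _ + X]big1 ?addr0 => [|jk _]; last by rewrite rmorph0 scale0r.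
  by rewrite /v0 div1r fmorphV rmorphD rmorph1 rmorph_nat.
by rewrite big1 // => j _; rewrite rmorph0 scale0r.
Qed.

Lemma v_real_comb i : v a b c d i = real_comb e (coef i).
Proof.
rewrite /real_comb sum_basis_index /= /v -!addrA; congr (_ + _).
  apply: eq_bigr => j _; congr (_ *: _).
  by rewrite mulN1r rmorphN fmorphV rmorphM rmorphXn rmorphD rmorph1 rmorph_nat.
congr (_ + _).
  rewrite (bigD1 i) //= eqxx mul1r big1 ?addr0 => [|j /negPf ->].
    by rewrite div1r fmorphV rmorphD rmorph1 rmorph_nat.
  by rewrite mul0r rmorph0 scale0r.
rewrite addrA; congr (_ + _).
  pose G (jk : 'I_N * 'I_N) := ((((jk.2 == i)%:R - (jk.1 == i)%:R)
     * (m%:R * (m%:R + 1))^-1 : R)%:C) *: c jk.1 jk.2.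
  rewrite (sum_ltn_pairs G) -(pair_big_dep xpredT (fun j k : 'I_N => (j < k)%N)
    (fun j k => G (j, k))) /=.
  pose x : R[i] := (m%:R * (m%:R + 1))^-1.
  (* The first term survives for [k = i] and yields the vectors [c_ji]; the second survives for
     [j = i] and yields the vectors [c_ij] with their minus sign. *)
  have GE j k : G (j, k) = ((k == i)%:R * x) *: c j k - ((j == i)%:R * x) *: c j k.
    rewrite -scalerBl -mulrBl /G /x; congr (_ *: _).
    by rewrite rmorphM rmorphB !rmorph_nat fmorphV rmorphM rmorphD rmorph1 rmorph_nat.
  under [RHS]eq_bigr => j _ do under eq_bigr => k _ do rewrite GE.
  under [RHS]eq_bigr => j _ do rewrite sumrB.
  rewrite sumrB; congr (_ + _).
    rewrite big_mkcond; apply: eq_bigr => j _; rewrite big_mkcond (bigD1 i) //=.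
    rewrite eqxx mul1r /x big1 ?addr0 ?div1r // => k /negPf ->.
    by rewrite mul0r scale0r if_same.
  rewrite [X in _ = - X](bigD1 i) //= [X in _ = - (_ + X)]big1 ?addr0.
    rewrite -sumrN; apply: eq_bigr => k _.
    by rewrite eqxx mul1r mulN1r scaleNr.
  by move=> j /negPf ->; rewrite big1 // => k _; rewrite mul0r scale0r.
rewrite [RHS](bigD1 i) //= [X in _ = _ + X]big1 ?addr0 => [|j /negPf ->].
  by apply: eq_bigr => j _; rewrite eqxx !mul1r.
by rewrite big1 // => k _; rewrite mul0r rmorph0 scale0r.
Qed.

End Vectors.

(** The weight is arbitrary so that the signs of [s] give [<v_0 s, v_0>], while the constant 1 gives
    [|v_0|^2]. The next lemma does the same for [v_0] and [v_i]. *)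
Lemma sum_coef0_sqr (sg : K -> R) :
  \sum_k sg k * coef0 k * coef0 k =
  (\sum_i sg (inl (inl (inl i))) + \sum_i sg (inl (inl (inr i))))
  / (m%:R + 1) ^+ 2.
Proof.
rewrite sum_basis_index /= [X in _ + X]big1 ?addr0 => [|i _].
  rewrite [X in _ + X]big1 ?addr0 => [|jk _]; last by rewrite mulr0.
  rewrite mulrDl !mulr_suml.
  by congr (_ + _); apply: eq_bigr => i _; rewrite -mulrA -expr2 exprVn.
by rewrite big1 // => j _; rewrite mulr0.
Qed.

Lemma sum_coef0_coef (sg : K -> R) i :
  \sum_k sg k * coef0 k * coef i k =
  (sg (inl (inl (inr i))) - (\sum_j sg (inl (inl (inl j)))) / m%:R ^+ 2)
  / (m%:R + 1) ^+ 2.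
Proof.
rewrite sum_basis_index /= [X in _ + X]big1 ?addr0 => [|j _]; last first.
  by rewrite big1 // => k _; rewrite mulr0 mul0r.
rewrite [X in _ + X]big1 ?addr0 => [|jk _]; last by rewrite mulr0 mul0r.
under [X in _ + X]eq_bigr => j _ do rewrite mulrCA.
rewrite sum_delta addrC mulrBl; congr (_ + _).
  by rewrite -mulrA -expr2 exprVn.
rewrite !mulr_suml -sumrN; apply: eq_bigr => j _.
by rewrite mulrN invfM -!mulrA [(_ + _)^-1 * _]mulrCA -expr2 exprVn.
Qed.

(* The summand is symmetric in [kl] and vanishes on the diagonal, so the sum is
   half of the unrestricted one. *)
Lemma sum_ltn_coef i j :
  \sum_(kl : 'I_N * 'I_N | (kl.1 < kl.2)%N)
     ((kl.2 == i)%:R - (kl.1 == i)%:R) * ((kl.2 == j)%:R - (kl.1 == j)%:R)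
  = (i == j)%:R * N%:R - 1 :> R.
Proof.
pose g (k l : 'I_N) : R :=
  ((l == i)%:R - (k == i)%:R) * ((l == j)%:R - (k == j)%:R).
apply: (@mulfI _ 2); first by rewrite pnatr_eq0.
rewrite -[LHS](@sum_ltn_symmetric _ _ g); first last.
- by move=> k; rewrite /g subrr mul0r.
- by move=> k l; rewrite /g -mulrNN !opprB.
have sum_in k : \sum_l g k l = (i == j)%:R - (k == j)%:R * 1
    - (k == i)%:R * 1 + ((k == i)%:R * (k == j)%:R) *+ N.
  transitivity (\sum_l ((l == i)%:R * (l == j)%:R
      - (l == i)%:R * ((k == j)%:R * 1) - (l == j)%:R * ((k == i)%:R * 1)
      + (k == i)%:R * (k == j)%:R) : R).
    by apply: eq_bigr => l _; rewrite /g; ring.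
  by rewrite big_split /= !sumrB !sum_delta sumr_const card_ord.
under eq_bigr => k _ do rewrite sum_in.
rewrite big_split /= !sumrB [X in _ + X = _]sumrMnl !sum_delta sumr_const card_ord.
by move: (i == j)%:R => t; rewrite -mulr_natr; ring.
Qed.

(** * Orthonormality of the [v_i] and diagonal entries of [p], in coordinates *)

Section Gram.
Hypothesis m_gt0 : (0 < m)%N.

Lemma natr_gt0 : 0 < m%:R :> R. Proof. by rewrite ltr0n. Qed.
Lemma natr1_gt0 : 0 < m%:R + 1 :> R. Proof. by rewrite natr1 ltr0n. Qed.

Lemma natrN : N%:R = 2 * m%:R + 1 :> R.
Proof. by rewrite natrD natrM. Qed.

Lemma sqrt_ratio_sqr :
  (m%:R^-1 * Num.sqrt ((m%:R - 1) / (m%:R + 1))) ^+ 2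
  = (m%:R - 1) / (m%:R ^+ 2 * (m%:R + 1)) :> R.
Proof.
rewrite exprMn sqr_sqrtr; last first.
  by rewrite divr_ge0 ?(ltW natr1_gt0) // subr_ge0 ler1n.
have := natr_gt0; have := natr1_gt0; move=> /gt_eqF h1 /gt_eqF h.
by field; rewrite h h1.
Qed.

(** For [i != j] only the [a] and [c] parts are nonzero, namely [1 / (m^2 (m + 1)^2)] and its
    negative. For [i = j] the [a], [b] and [c] parts add up to [1 / m^2], and the [d] part is
    [1 - 1 / m^2]. *)
Lemma sum_coef i j : \sum_k coef i k * coef j k = (i == j)%:R.
Proof.
have h := natr_gt0; have h1 := natr1_gt0.
rewrite sum_basis_index /= sumr_const card_ord -[_ *+ m ^ 2]mulr_natl.
under [X in _ + X + _ + _]eq_bigr => k _ do rewrite -mulrA.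
rewrite sum_delta.
pose G (kl : 'I_N * 'I_N) : R :=
  ((kl.2 == i)%:R - (kl.1 == i)%:R) * (m%:R * (m%:R + 1))^-1
  * (((kl.2 == j)%:R - (kl.1 == j)%:R) * (m%:R * (m%:R + 1))^-1).
rewrite (sum_ltn_pairs G).
have -> : \sum_(kl : 'I_N * 'I_N | (kl.1 < kl.2)%N) G kl
    = ((i == j)%:R * N%:R - 1) * (m%:R * (m%:R + 1))^-1 ^+ 2.
  rewrite -sum_ltn_coef mulr_suml; apply: eq_bigr => kl _.
  by rewrite /G mulrACA -expr2.
have -> (t : R) : \sum_(k < N) \sum_(l < (m + 1) ^ 2) ((k == i)%:R * t * ((k == j)%:R * t))
    = (i == j)%:R * ((m + 1) ^ 2)%:R * t ^+ 2.
  under eq_bigr => k _ do rewrite sumr_const card_ord -[_ *+ (m + 1) ^ 2]mulr_natl mulrCA -!mulrA.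
  by rewrite sum_delta; ring.
rewrite sqrt_ratio_sqr natrN !natrX natrD.
by case: (i == j) => /=; field; rewrite !gt_eqF.
Qed.

(** This is the diagonal entry of [p] at [b_j], to which only [v_0] and [v_j] contribute, equally;
    [delta] is attained here. *)
Lemma sum_coef_sqr_b j :
  coef0 (inl (inl (inr j))) ^+ 2 + \sum_i coef i (inl (inl (inr j))) ^+ 2 =
  2 / (m%:R + 1) ^+ 2.
Proof.
rewrite /=.
under eq_bigr => i _ do rewrite eq_sym expr2 -mulrA.
by rewrite sum_delta eqxx mul1r -expr2 exprVn -mulr2n mulr_natl.
Qed.

(** Up to the factor [1 / (m + 1)^2], the diagonal entries of [p] are [1 + (2 m + 1) / m^4] at
    [a_i], 2 at [b_i], [2 / m^2] at [c_ij] and [(m^2 - 1) / m^2] at [d_ij]. The first exceeds 2 when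
    [m = 1]. *)
Lemma sum_coef_sqr_le k : (1 < m)%N ->
  coef0 k ^+ 2 + \sum_i coef i k ^+ 2 <= 2 / (m%:R + 1) ^+ 2.
Proof.
move=> m_gt1; have h := natr_gt0; have h1 := natr1_gt0.
have hm : 2 <= m%:R :> R by rewrite ler_nat.
have m1V_ge0 : 0 <= (m%:R + 1)^-1 ^+ 2 :> R by rewrite sqr_ge0.
rewrite -[in leRHS]exprVn; case: k => [[[i|j]|jk]|[i l]].
- rewrite /= sumr_const card_ord -[_ *+ N]mulr_natl natrN.
  rewrite sqrrN invfM exprMn [(_ ^+ 2)^-1 ^+ 2]exprVn mulrA.
  have le1 : (2 * m%:R + 1) / (m%:R ^+ 2) ^+ 2 <= 1 :> R.
    rewrite ler_pdivrMr ?mul1r ?exprn_gt0 //.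
    have : 4 <= m%:R ^+ 2 :> R by nra.
    by nra.
  by move: (ler_wpM2r m1V_ge0 le1); lra.
- by rewrite [in leRHS]exprVn sum_coef_sqr_b.
- case: jk => -[j l] /= jl; rewrite expr0n add0r.
  (* The square of a difference of two indicators is at most their sum. *)
  apply: (@le_trans _ _ (\sum_i ((i == l)%:R * 1 + (i == j)%:R * 1)
     * (m%:R * (m%:R + 1))^-1 ^+ 2)).
    apply: ler_sum => i _; rewrite exprMn ler_wpM2r ?sqr_ge0 //.
    by rewrite ![_ == i]eq_sym; do 2!case: eqP => _ /=; lra.
  rewrite -mulr_suml big_split /= !sum_delta invfM exprMn mulrA ler_wpM2r //.
  by rewrite exprVn ler_pdivrMr ?exprn_gt0 //; nra.
- rewrite /= expr0n add0r.
  under eq_bigr => j _ do rewrite eq_sym expr2 -mulrA.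
  rewrite sum_delta eqxx mul1r -expr2 sqrt_ratio_sqr exprVn.
  rewrite ler_pdivrMr ?mulr_gt0 ?exprn_gt0 // mulrAC ler_pdivlMr ?exprn_gt0 //.
  by nra.
Qed.

End Gram.

End Coefficients.

(** * The value of [delta] and the lower bound for the norm of [p s p] *)

Lemma sum_sqr_sign_ge (R : realType) n (bt : 'I_n -> R) (al M : R) :
  1 <= M -> (forall i, bt i ^+ 2 = 1) ->
  n%:R <= (al + \sum_i bt i) ^+ 2 + \sum_i (bt i - al / M) ^+ 2.
Proof.
move=> M_ge1 bt2; set B := \sum_i bt i; set t := al / M.
have -> : al = M * t by rewrite /t mulrC divfK // gt_eqF // (lt_le_trans _ M_ge1).
have -> : \sum_i (bt i - t) ^+ 2 = n%:R - 2 * t * B + n%:R * t ^+ 2.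
  transitivity (\sum_i (1 - 2 * t * bt i + t ^+ 2)).
    by apply: eq_bigr => i _; rewrite sqrrB bt2; ring.
  rewrite big_split sumrB -mulr_sumr !sumr_const card_ord /=.
  by rewrite [n%:R * _]mulr_natl.
have : 0 <= n%:R * t ^+ 2 by rewrite mulr_ge0 ?sqr_ge0.
have : 2 * (t * B) <= (M * t + B) ^+ 2; last by lra.
(* Only a positive [t * B] matters, and then [(M t + B)^2 >= 4 M t B >= 2 t B] because [1 <= M]. *)
have [tB_le0|tB_ge0] := leP (t * B) 0; first by have := sqr_ge0 (M * t + B); lra.
by have := sqr_ge0 (M * t - B); nra.
Qed.

Section LowerBound.
Variables (R : realType) (m : nat).
Local Notation N := (2 * m + 1)%N.
Local Notation H := 'rV[R[i]]_(dimH m).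
Hypothesis m_gt1 : (1 < m)%N.
Variables (a : 'I_(m ^ 2) -> H) (b : 'I_N -> H) (c : 'I_N -> 'I_N -> H).
Variable d : 'I_N -> 'I_((m + 1) ^ 2) -> H.
Local Notation e := (basis_vector a b c d).
Local Notation p := (proj_ortho (vmx a b c d)).
Hypothesis dot_e : forall k l, dotmx (e k) (e l) = (k == l)%:R.

Let m_gt0 : (0 < m)%N. Proof. exact: ltnW. Qed.

Lemma dotmx_v0 : dotmx (v0 a b) (v0 a b) = 1.
Proof.
rewrite (v0_real_comb a b c d) dotmx_real_comb //.
under eq_bigr => k _ do rewrite -[X in X * _]mul1r.
rewrite sum_coef0_sqr !sumr_const !card_ord natrX natrD natrM.
rewrite (_ : _ / _ = 1) //; have := natr1_gt0 R m.
by move=> /gt_eqF h; field; rewrite h.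
Qed.

Lemma dotmx_v0_v i : dotmx (v0 a b) (v a b c d i) = 0.
Proof.
rewrite (v0_real_comb a b c d) v_real_comb dotmx_real_comb //.
under eq_bigr => k _ do rewrite -[X in X * _]mul1r.
rewrite sum_coef0_coef sumr_const card_ord natrX divff ?subrr ?mul0r ?rmorph0 //.
by rewrite expf_neq0 // gt_eqF // natr_gt0.
Qed.

Lemma dotmx_v i j : dotmx (v a b c d i) (v a b c d j) = (i == j)%:R.
Proof. by rewrite !v_real_comb dotmx_real_comb // sum_coef // rmorph_nat. Qed.

Lemma orthonormal_v : orthonormal (@dotmx R[i] (dimH m)) (v0 a b :: codom (v a b c d)).
Proof.
rewrite -cat1s orthonormal_cat; apply/and3P; split.
- by rewrite /orthonormal /= andbT; apply/andP; split; rewrite ?dotmx_v0.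
- by apply/orthonormal_codomP; exact: dotmx_v.
- by apply/orthoPl => _ /codomP[i ->]; exact: dotmx_v0_v.
Qed.

Lemma row_vmx0 : row (lshift N ord0) (vmx a b c d) = v0 a b.
Proof. by rewrite rowKu; apply/rowP => j; rewrite mxE. Qed.

Lemma row_vmx i : row (rshift 1 i) (vmx a b c d) = v a b c d i.
Proof. by rewrite rowKd rowK. Qed.

Lemma sum_row_vmx (V : nmodType) (F : H -> V) :
  \sum_i F (row i (vmx a b c d)) = F (v0 a b) + \sum_i F (v a b c d i).
Proof.
rewrite big_split_ord big_ord1 row_vmx0 /=; congr (_ + _).
by apply: eq_bigr => i _; rewrite row_vmx.
Qed.

Lemma vmx_unitary : vmx a b c d \is unitarymx.
Proof.
apply/row_unitarymxP => i j.
case: (split_ordP i) => k ->; case: (split_ordP j) => l ->.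
- by rewrite !ord1 row_vmx0 dotmx_v0 eqxx.
- by rewrite ord1 row_vmx0 row_vmx dotmx_v0_v eq_lrshift.
- rewrite ord1 row_vmx0 row_vmx eq_rlshift.
  by have := dotmx_v0_v k; rewrite hermC /= => /eqP; rewrite expr0 mul1r conjC_eq0 => /eqP.
- by rewrite !row_vmx dotmx_v eq_rshift.
Qed.

Lemma is_projection_p : is_projection p.
Proof. by split; [exact: proj_ortho_hermitian vmx_unitary | exact: proj_ortho_proj]. Qed.

(** Parseval along the rows of [vmx]. An indicator [f] gives a diagonal entry of [p]; the
    coordinates of [v_0 s] give [|v_0 s p|^2]. *)
Lemma dotmx_real_comb_p f :
  dotmx (real_comb e f *m p) (real_comb e f) =
  ((\sum_k f k * coef0 R k) ^+ 2 + \sum_i (\sum_k f k * coef R i k) ^+ 2)%:C.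
Proof.
rewrite dotmx_proj_ortho ?vmx_unitary //.
rewrite (sum_row_vmx (fun w => dotmx (real_comb e f) w
  * (dotmx (real_comb e f) w)^*%R)).
rewrite (v0_real_comb a b c d) dotmx_real_comb // rmorphD /=.
congr (_ + _); first by rewrite expr2 rmorphM; congr (_ * _); exact: conjc_real.
rewrite rmorph_sum; apply: eq_bigr => i _.
rewrite v_real_comb dotmx_real_comb // expr2 rmorphM.
by congr (_ * _); exact: conjc_real.
Qed.

Lemma basis_vector_real_comb k : e k = real_comb e (fun l => (l == k)%:R).
Proof.
rewrite /real_comb (bigD1 k) //= eqxx rmorph1 scale1r big1 ?addr0 // => l.
by move=> /negPf ->; rewrite rmorph0 scale0r.
Qed.

Lemma dotmx_basis_p k :
  complex.Re (dotmx (e k *m p) (e k)) = coef0 R k ^+ 2 + \sum_i coef R i k ^+ 2.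
Proof.
rewrite [e k]basis_vector_real_comb dotmx_real_comb_p /=.
have sumE (F : basis_index m -> R) : \sum_l (l == k)%:R * F l = F k.
  by rewrite (bigD1 k) //= eqxx mul1r big1 ?addr0 // => l /negPf ->; rewrite mul0r.
by rewrite sumE; under eq_bigr => i _ do rewrite sumE.
Qed.

Lemma delta_p : delta e p = 2 / (m%:R + 1) ^+ 2.
Proof.
apply/le_anti/andP; split.
  (* The maximum starts from 0, so the bound must be nonnegative as well. *)
  apply/bigmax_leP; split; first by rewrite divr_ge0 ?sqr_ge0.
  by move=> k _; rewrite dotmx_basis_p sum_coef_sqr_le.
have j : 'I_N by rewrite addn1; exact: ord0.
rewrite -(sum_coef_sqr_b R j) -dotmx_basis_p.
exact: le_bigmax.
Qed.

Lemma opnorm_psp_ge (s : 'M[R[i]]_(dimH m)) :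
  is_symmetry s -> diagonal_in e s ->
  Num.sqrt (2 * m%:R + 1) / (m%:R + 1) ^+ 2 <= opnorm (p *m s *m p).
Proof.
move=> s_sym /(symmetry_diagonalE dot_e s_sym)[sg sg2 sE].
have v0_p : v0 a b *m p = v0 a b.
  by rewrite proj_ortho_id // -row_vmx0 row_sub.
apply: (@le_trans _ _ (l2norm (v0 a b *m (p *m s *m p)))); last first.
  by apply: le_opnorm; rewrite /l2norm dotmx_v0 sqrtr1.
have -> : v0 a b *m (p *m s *m p) = v0 a b *m s *m p.
  by rewrite (mulmxA (v0 a b)) (mulmxA (v0 a b)) v0_p.
rewrite (v0_real_comb a b c d) sE.
(* As [p] is a self-adjoint idempotent, [|w p|^2 = <w p, w>] for [w = v_0 s]. *)
rewrite /l2norm dotmx_hermitian; last exact: is_projection_p.1.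
rewrite -mulmxA is_projection_p.2 dotmx_real_comb_p /=.
rewrite sum_coef0_sqr; under eq_bigr => i _ do rewrite sum_coef0_coef exprMn.
rewrite exprMn -mulr_suml -mulrDl sqrtrM ?addr_ge0 ?sqr_ge0 ?sumr_ge0 //; last first.
  by move=> i _; rewrite sqr_ge0.
rewrite sqrtr_sqr ger0_norm ?invr_ge0 ?sqr_ge0 // ler_wpM2r ?invr_ge0 ?sqr_ge0 //.
(* The sign inequality is applied to the signs at the [b_i], with [al] the sum of the signs at the
   [a_i] and [M = m^2]. *)
rewrite ler_wsqrtr // -natrN sum_sqr_sign_ge // -natrX ler1n.
by rewrite expn_gt0 m_gt0.
Qed.

End LowerBound.

(** * Dimension count and labelling of the standard basis *)

Lemma card_ltn_pairs n :
  (2 * #|{: {ij : 'I_n * 'I_n | (ij.1 < ij.2)%N}}| = n * (n - 1))%N.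
Proof.
(* This is the indicator of [j != k]; each row sums to [n - 1], and the sum over [j < k] counts the
   pairs. *)
pose g (j k : 'I_n) : int := 1 - (k == j)%:R.
have gC j k : g j k = g k j by rewrite /g eq_sym.
have g0 j : g j j = 0 by rewrite /g eqxx subrr.
have := sum_ltn_symmetric gC g0.
have -> : \sum_(jk : 'I_n * 'I_n | (jk.1 < jk.2)%N) g jk.1 jk.2
    = #|{: {ij : 'I_n * 'I_n | (ij.1 < ij.2)%N}}|%:R.
  rewrite card_sig -sum1_card natr_sum; apply: eq_bigr => -[j k] /= jk.
  by rewrite /g; case: eqP => [kj|]; rewrite ?subr0 //; rewrite kj ltnn in jk.
have -> : \sum_(j < n) \sum_(k < n) g j k = (n * (n - 1))%:R :> int.
  transitivity (\sum_(j < n) (n - 1)%:R : int); last first.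
    by rewrite sumr_const card_ord mulnC natrM mulr_natr.
  apply: eq_bigr => j _; rewrite /g.
  rewrite sumrB sumr_const card_ord (bigD1 j) //= eqxx big1 ?addr0 => [|k /negPf -> //].
  (* The index [j] witnesses [1 <= n], so the truncated subtraction is exact. *)
  by rewrite natrB // (leq_trans _ (ltn_ord j)).
by rewrite -natrM => /eqP; rewrite eqr_nat => /eqP ->.
Qed.

Lemma card_basis_index m : #|basis_index m| = dimH m.
Proof.
rewrite !card_sum card_prod !card_ord.
have := card_ltn_pairs (2 * m + 1); rewrite /dimH.
move: #|_| => X; lia.
Qed.

Lemma dotmx_std_basis (R : realType) n (i j : 'I_n) :
  dotmx (std_basis R n i) (std_basis R n j) = (i == j)%:R.
Proof.
rewrite dotmx_sum (bigD1 i) //= big1 ?addr0 => [|k ki].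
  by rewrite !mxE !eqxx mul1r; case: eqP; rewrite ?rmorph1 ?rmorph0.
by rewrite !mxE (negPf ki) mul0r.
Qed.

Lemma is_onb_std_basis (R : realType) n (K : finType) (f : K -> 'I_n) :
  bijective f -> is_onb (fun k => std_basis R n (f k)).
Proof.
move=> f_bij; have e_on : orthonormal (@dotmx R[i] n) (codom (std_basis R n \o f)).
  apply/orthonormal_codomP => k l /=; rewrite dotmx_std_basis.
  by rewrite (inj_eq (bij_inj f_bij)).
split=> //; rewrite basisEfree subvf (orthonormal_free e_on) /=.
by rewrite size_codom dimvf /dim /= mul1n (bij_eq_card f_bij) card_ord.
Qed.

(** The conjecture concerns the standard basis, the bounds a basis labelled by [a], [b], [c], [d];
    equality of [#|basis_index m|] and [dimH m] lets one be read as the other. *)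
Lemma std_basis_labelling (R : realType) m :
  exists f : basis_index m -> 'I_(dimH m), bijective f /\
  exists a b c d, forall k, basis_vector a b c d k = std_basis R (dimH m) (f k).
Proof.
pose f k := cast_ord (card_basis_index m) (enum_rank k).
pose e k := std_basis R (dimH m) (f k).
exists f; split.
  exists (fun i => enum_val (cast_ord (esym (card_basis_index m)) i)) => i.
    by rewrite /f cast_ordK enum_rankK.
  by rewrite /f enum_valK cast_ordKV.
exists (fun i => e (inl (inl (inl i)))), (fun i => e (inl (inl (inr i)))).
(* For [j <= i] the pair is not a label, [insub] fails, and the default value 0 is taken. *)
exists (fun i j => oapp (fun ij => e (inl (inr ij))) 0 (insub (i, j))).
exists (fun i j => e (inr (i, j))) => -[[[i|j]|ij]|[i j]] //=.
by rewrite -surjective_pairing valK.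
Qed.

Lemma diagonal_in_std_basis (R : realType) n (K : finType) (f : K -> 'I_n)
    (s : 'M[R[i]]_n) :
  is_diag_mx s -> diagonal_in (fun k => std_basis R n (f k)) s.
Proof.
move=> /is_diag_mxP s_diag k; exists (s (f k) (f k)); rewrite -rowE.
apply/rowP => j; rewrite !mxE eqxx /=; case: eqP => [->|/eqP jk].
  by rewrite mulr1.
by rewrite mulr0 s_diag // eq_sym.
Qed.

Lemma delta_reindex (R : realType) n (K L : finType) (e : L -> 'rV[R[i]]_n)
    (f : K -> L) p :
  bijective f -> delta (fun k => e (f k)) p = delta e p.
Proof.
move=> [g fK gK]; apply/le_anti/andP; split; apply/bigmax_leP.
  by split=> [|k _]; [exact: bigmax_ge_id | apply: (bigmax_sup (f k))].
split=> [|l _]; first exact: bigmax_ge_id.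
by apply: (bigmax_sup (g l)); rewrite ?gK.
Qed.

(** * Failure of the conjecture at [m = 8], and the combined statement *)

Lemma not_Akemann_Anderson (R : realType) : ~ Akemann_Anderson_conjecture R.
Proof.
(* [m] is kept opaque so that [dimH m] is never computed. *)
have [m m_eq] : exists m, m = 8%N by exists 8%N.
have m_gt1 : (1 < m)%N by rewrite m_eq.
have [f [f_bij [a [b [c [d eE]]]]]] := std_basis_labelling R m.
have eE' : basis_vector a b c d = fun k => std_basis R (dimH m) (f k) by exact/funext.
have [e_on _] : is_onb (basis_vector a b c d).
  by rewrite eE'; exact: is_onb_std_basis.
have dot_e := elimT (orthonormal_codomP _) e_on.
have dim_gt0 : (1 <= dimH m)%N by rewrite /dimH addn2.
move=> /(_ _ dim_gt0 _ (is_projection_p m_gt1 dot_e))[s [s_sym s_diag]].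
rewrite -(delta_reindex _ _ f_bij) -eE' delta_p //.
have s_diag' : diagonal_in (basis_vector a b c d) s.
  by rewrite eE'; exact: diagonal_in_std_basis.
move=> /(le_trans (opnorm_psp_ge m_gt1 dot_e s_sym s_diag')).
(* Cancelling [(m + 1)^2] leaves [sqrt (2 m + 1) <= 4]; squared at [m = 8], this reads
   [17 <= 16]. *)
rewrite mulrA ler_pM2r ?invr_gt0 ?exprn_gt0 ?natr1_gt0 //.
rewrite -(ler_pXn2r (n := 2)) ?nnegrE ?sqrtr_ge0 ?mulr_ge0 //.
by rewrite sqr_sqrtr ?addr_ge0 ?mulr_ge0 // m_eq; lra.
Qed.

Theorem mainTheorem1 (R : realType) :
  (forall (m : nat) (hm : (6 <= m)%N)
     (a : 'I_(m ^ 2) -> 'rV[R[i]]_(dimH m))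
     (b : 'I_(2 * m + 1) -> 'rV[R[i]]_(dimH m))
     (c : 'I_(2 * m + 1) -> 'I_(2 * m + 1) -> 'rV[R[i]]_(dimH m))
     (d : 'I_(2 * m + 1) -> 'I_((m + 1) ^ 2) -> 'rV[R[i]]_(dimH m)),
   let e := basis_vector a b c d in
   is_onb e ->
   orthonormal (@dotmx R[i] (dimH m)) (v0 a b :: codom (v a b c d)) /\
   let p := proj_ortho (vmx a b c d) in
   delta e p = 2 / (m%:R + 1) ^+ 2 /\
   forall s : 'M[R[i]]_(dimH m), is_symmetry s -> diagonal_in e s ->
     opnorm (p *m s *m p) >= Num.sqrt (2 * m%:R + 1) / 4 * delta e p)
  /\ ~ Akemann_Anderson_conjecture R.
Proof.
split; last exact: not_Akemann_Anderson.
move=> m hm a b c d e [/orthonormal_codomP dot_e _].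
have m_gt1 : (1 < m)%N := leq_trans (isT : 2 <= 6)%N hm.
split; first exact: orthonormal_v.
move=> p; have delta_pE : delta e p = 2 / (m%:R + 1) ^+ 2 by exact: delta_p.
split=> // s s_sym s_diag; rewrite delta_pE.
apply: le_trans (opnorm_psp_ge m_gt1 dot_e s_sym s_diag).
(* With [(m + 1)^2] cancelled, the claim is that half of [sqrt (2 m + 1)] is at most the whole. *)
rewrite mulrA ler_wpM2r ?invr_ge0 ?sqr_ge0 //.
by have := sqrtr_ge0 (2 * m%:R + 1 : R); lra.
Qed.
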